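(* Let $(k,\tau)$ be a field with a ring topology. Then $(k,\tau)$ is rigid. In particular, any topological field is rigid.
   Context: All topologies are Hausdorff. A ring topology on a commutative unital ring is a (Hausdorff) topology making addition, negation and multiplication (jointly) continuous. A field with a ring topology is a field $k$ with a ring topology $\tau$ (inversion is not assumed continuous); it is a topological field if moreover $\alpha\mapsto\alpha^{-1}$ is continuous on $k\setminus\{0\}$ for the subspace topology. For a topological commutative ring $(R,\tau)$ and a set $X$, $(R,\tau)^X$ is the $R$-module $R^X$ of all maps $X\to R$ with the product topology, $R^{(X)}$ is the submodule of finitely supported maps, and $((R,\tau)^X)'$ is the $R$-module of continuous $R$-linear maps $(R,\tau)^X\to(R,\tau)$. $(R,\tau)$ is rigid if for every set $X$ the $R$-linear map $\lambda_X\colon R^{(X)}\to((R,\tau)^X)'$, $\lambda_X(p)(f)=\sum_{x\in X}p(x)f(x)$, is an isomorphism. *)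

(* Defs.v *)
From HB Require Import structures.
From mathcomp Require Import all_boot all_order all_algebra.
From mathcomp Require Import finmap all_classical all_reals topology tvs.

Set Implicit Arguments.
Unset Strict Implicit.
Unset Printing Implicit Defensive.

Import GRing.Theory.

Local Open Scope classical_set_scope.
Local Open Scope ring_scope.

HB.mixin Record TopologicalZmodule_isTopologicalComRing R
    & TopologicalZmodule R & GRing.ComPzRing R := {
  topring_mul_continuous : continuous (fun z : R * R => z.1 * z.2) ;
  topring_hausdorff : hausdorff_space R ;
}.

(* [ComPzRing] rather than [ComNzRing]: the zero ring is allowed. *)
#[short(type="topComRingType")]
HB.structure Definition TopologicalComRing :=
  {R of TopologicalZmodule R & GRing.ComPzRing R
      & TopologicalZmodule_isTopologicalComRing R}.

#[short(type="ringTopFieldType")]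
HB.structure Definition RingTopologicalField :=
  {k of TopologicalComRing k & GRing.Field k}.

HB.mixin Record RingTopologicalField_isTopologicalField k
    & RingTopologicalField k := {
  topfield_inv_continuous :
    {within [set x : k | x != 0], continuous (fun x : k => x^-1)} ;
}.

#[short(type="topFieldType")]
HB.structure Definition TopologicalField :=
  {k of RingTopologicalField k & RingTopologicalField_isTopologicalField k}.

Section ContinuousOperations.
Variables (T : topologicalType) (R : topComRingType).
Implicit Types f g : T -> R.

Lemma topring_continuousD f g :
  continuous f -> continuous g -> continuous (fun x => f x + g x).
Proof.
move=> cf cg x.
apply: (@continuous_comp _ _ _ (fun x => (f x, g x)) (fun z => z.1 + z.2)).
  by apply: cvg_pair; [exact: cf|exact: cg].
exact: add_continuous.
Qed.

Lemma topring_continuousM f g :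
  continuous f -> continuous g -> continuous (fun x => f x * g x).
Proof.
move=> cf cg x.
apply: (@continuous_comp _ _ _ (fun x => (f x, g x)) (fun z => z.1 * z.2)).
  by apply: cvg_pair; [exact: cf|exact: cg].
exact: topring_mul_continuous.
Qed.

End ContinuousOperations.

Definition power (R X : Type) : Type := X -> R.

HB.instance Definition _ (R : pzRingType) (X : Type) :=
  GRing.Lmodule.copy (power R X) (X -> R^o).
HB.instance Definition _ (R : topologicalType) (X : Type) :=
  Topological.copy (power R X) {ptws X -> R}.

Section FinitelySupported.
Variables (R : pzRingType) (X : Type).

Definition finsupp_pred : {pred power R X} :=
  [pred p : power R X | `[< finite_set [set x | p x != 0] >]].

Lemma finsupp_submod_closed : submod_closed finsupp_pred.
Proof.
split=> [|a u v /asboolP fu /asboolP fv]; apply/asboolP.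
  rewrite (_ : mkset _ = set0) //; apply/seteqP; split=> x //=.
  by move/eqP; apply.
apply: sub_finite_set (_ : _ `<=` [set x | u x != 0] `|` [set x | v x != 0]) _.
  move=> x /=; have [ux|] := eqVneq (u x) 0; last by left.
  have [vx|] := eqVneq (v x) 0; last by right.
  by rewrite -[(_ + _) x]/(a * u x + v x) ux vx mulr0 addr0 eqxx.
by rewrite finite_setU.
Qed.

HB.instance Definition _ :=
  GRing.isSubmodClosed.Build R (power R X) finsupp_pred finsupp_submod_closed.

Record finsupp := Finsupp {
  finsupp_val : power R X ;
  finsupp_valP : finsupp_val \in finsupp_pred
}.

HB.instance Definition _ := [isSub for finsupp_val].
HB.instance Definition _ := [Choice of finsupp by <:].
HB.instance Definition _ := [SubChoice_isSubLmodule of finsupp by <:].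

Definition finsupp_fun (p : finsupp) : X -> R := finsupp_val p.

End FinitelySupported.

Coercion finsupp_fun : finsupp >-> Funclass.

Section ContinuousDual.
Variables (R : topComRingType) (X : Type).

Definition dual_pred : {pred power R X -> R^o} :=
  [pred l : power R X -> R^o |
     `[< linear l /\ continuous (l : power R X -> R) >]].

Lemma dual_submod_closed : submod_closed dual_pred.
Proof.
split=> [|a l m /asboolP[linl cl] /asboolP[linm cm]]; apply/asboolP; split.
- by move=> a u v /=; rewrite scaler0 addr0.
- exact: cst_continuous.
- move=> b u v; rewrite -![(_ + _ : _ -> _) _]/(a *: l _ + m _) linl linm.
  by rewrite !scalerDr !scalerA (mulrC a b) addrACA.
apply: (@topring_continuousD _ R (fun f => a * l f) m) cm.
by apply: (@topring_continuousM _ R (cst a) l) cl; exact: cst_continuous.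
Qed.

HB.instance Definition _ :=
  GRing.isSubmodClosed.Build R (power R X -> R^o) dual_pred dual_submod_closed.

Record dual := Dual {
  dual_val :> power R X -> R^o ;
  dual_valP : dual_val \in dual_pred
}.

HB.instance Definition _ := [isSub for dual_val].
HB.instance Definition _ := [Choice of dual by <:].
HB.instance Definition _ := [SubChoice_isSubLmodule of dual by <:].

End ContinuousDual.

Section Lambda.
Variables (R : topComRingType) (X : Type).

(* A finite sum over [{classic X}] because [\sum_(_ \in _)] needs a choiceType;
   its summand is finitely supported as [p] is. *)
Definition lambda_fun (p : finsupp R X) (f : power R X) : R^o :=
  \sum_(x \in [set: {classic X}]) p x * f x.

Lemma lambda_funE (p : finsupp R X) (A : {fset {classic X}}) (f : power R X) :
  (forall x : {classic X}, x \notin A -> p x = 0) ->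
  lambda_fun p f = \sum_(x <- A) p x * f x.
Proof. by move=> pA; apply: fsbigTE => x /pA ->; rewrite mul0r. Qed.

Lemma finsupp_fset (p : finsupp R X) :
  exists A : {fset {classic X}}, forall x, x \notin A -> p x = 0.
Proof.
have /asboolP fp := finsupp_valP p.
exists (fset_set ([set x | p x != 0] : set {classic X})) => x.
by rewrite in_fset_set // notin_setE /= => /negP; rewrite negbK => /eqP.
Qed.

Lemma lambda_fun_dual (p : finsupp R X) : lambda_fun p \in @dual_pred R X.
Proof.
have [A pA] := finsupp_fset p; apply/asboolP; split=> [a u v|].
  rewrite !(lambda_funE _ pA) scaler_sumr -big_split /=; apply: eq_bigr => x _.
  by rewrite -[(_ + _ : power R X) x]/(a * u x + v x) mulrDr mulrCA.
rewrite (_ : lambda_fun p = fun f => \sum_(x <- A) p x * f x); last first.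
  by apply/funext => g; exact: lambda_funE.
elim: (enum_fset A) => [|x s IHs].
  rewrite (_ : (fun _ => _) = cst 0); first exact: cst_continuous.
  by apply/funext => g; rewrite big_nil.
rewrite (_ : (fun _ => _) =
    fun g : power R X => p x * g x + \sum_(y <- s) p y * g y); last first.
  by apply/funext => g; rewrite big_cons.
apply: (@topring_continuousD _ R (fun g : power R X => p x * g x)) IHs.
apply: (@topring_continuousM _ R (cst (p x)) (fun g : power R X => g x)).
  exact: cst_continuous.
exact: (@proj_continuous {classic X} (fun=> R) x).
Qed.

Definition lambda (p : finsupp R X) : dual R X := Dual (lambda_fun_dual p).

Lemma lambda_linear : linear lambda.
Proof.
move=> a p q; apply: val_inj; apply/funext => f.
have [A pA] := finsupp_fset p; have [B qB] := finsupp_fset q.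
pose C := (A `|` B)%fset.
have pC x : x \notin C -> p x = 0 by rewrite inE negb_or => /andP[/pA].
have qC x : x \notin C -> q x = 0 by rewrite inE negb_or => /andP[_ /qB].
have pqE x : (a *: p + q : finsupp R X) x = a * p x + q x by [].
rewrite -[LHS]/(lambda_fun (a *: p + q) f).
rewrite -[RHS]/(a *: lambda_fun p f + lambda_fun q f).
rewrite (lambda_funE _ pC) (lambda_funE _ qC) (@lambda_funE _ C); last first.
  by move=> x xC; rewrite pqE pC // qC // mulr0 addr0.
rewrite scaler_sumr -big_split; apply: eq_bigr => x _.
by rewrite pqE mulrDl -mulrA.
Qed.

HB.instance Definition _ :=
  GRing.isLinear.Build R (finsupp R X) (dual R X) *:%R lambda lambda_linear.

End Lambda.

(* [lambda R X] is linear, so it is an isomorphism of modules if and only if it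
   is bijective. *)
Definition rigid (R : topComRingType) : Prop :=
  forall X : Type, bijective (@lambda R X : {linear finsupp R X -> dual R X}).

(* Main.v *)
(** A continuous linear form [l] on [k^X] maps some subspace
    [W = {f | f = 0 on A}], with [A] finite, into a neighbourhood of [0] that
    misses [1].  As [l W] is a subspace of the field [k], it is [0]; hence
    [l f] only depends on the restriction of [f] to [A], and [l] is the
    combination of the evaluations at the points of [A] whose coefficients are
    the values of [l] at the unit vectors. *)

From HB Require Import structures.
(* Imported before [Defs], whose [finsupp] must shadow that of [finmap]. *)
From mathcomp Require Import finmap.
Require Import Defs.
From mathcomp Require Import all_boot all_order all_algebra.
From mathcomp Require Import all_classical all_reals topology tvs.

Set Implicit Arguments.
Unset Strict Implicit.
Unset Printing Implicit Defensive.

Import GRing.Theory.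

Local Open Scope classical_set_scope.
Local Open Scope ring_scope.

(** The sets [vanish A] generate a filter that converges to [0] in each coordinate, hence in the
    product topology. *)
Lemma nbhs0_power (R : topComRingType) (X : Type) (U : set (power R X)) :
  nbhs (0 : power R X) U ->
  exists A : {fset {classic X}},
    forall f : power R X, (forall x, x \in A -> f x = 0) -> U f.
Proof.
pose vanish (A : {fset {classic X}}) :=
  [set f : power R X | forall x, x \in A -> f x = 0].
pose F := filter_from setT vanish.
have FF : Filter F.
  apply: filter_fromT_filter => [|A B]; first by exists fset0.
  by exists (A `|` B)%fset => f AB0; split=> x xAB; apply: AB0;
    rewrite inE xAB ?orbT.
suff F0 : F --> (0 : power R X) by move=> /F0[A _ AU]; exists A => f; exact: AU.
(* The product topology is the supremum of those induced by the evaluations, so one [x] is treated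
   at a time. Constant maps show that evaluation at [x] is onto. *)
apply/cvg_sup => x; apply/cvg_image.
  by apply/seteqP; split=> // a _; exists (fun=> a).
move=> V /nbhs_singleton V0; exists (fun f : power R X => V (f x)).
  by exists [fset (x : {classic X})]%fset => // f fx0 /=; rewrite fx0 ?inE.
apply/seteqP; split=> [a [f Vf <-]//|a Va].
by exists (fun=> a).
Qed.

Lemma dual_vanish (k : ringTopFieldType) (X : Type) (l : dual k X) :
  exists A : {fset {classic X}},
    forall f : power k X, (forall x, x \in A -> f x = 0) -> l f = 0.
Proof.
have /asboolP[linl cl] := dual_valP l.
have l0 : l 0 = 0.
  by have := linl (-1) 0 0; rewrite scaler0 addr0 scaleN1r addNr.
have lZ a f : l (a *: f) = a *: l f by rewrite -[a *: f]addr0 linl l0 addr0.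
have nbhs0 : nbhs (0 : k) [set a | a != 1].
  have [V [oV V0 V1]] : exists V : set k, [/\ open V, 0 \in V & 1 \in ~` V].
    by apply: hausdorff_accessible; [exact: topring_hausdorff|rewrite eq_sym oner_neq0].
  apply: (filterS _ (open_nbhs_nbhs (conj oV (set_mem V0)))) => a Va /=.
  by apply: contraPneq Va => ->; exact: set_mem V1.
have [] := @nbhs0_power k X (l @^-1` [set a | a != 1]).
  by apply: cl; rewrite l0.
move=> A AU; exists A => f fA; apply/eqP/negPn/negP => lf0.
(* Rescaling keeps [f] zero on [A], yet brings its value under [l] to the excluded [1]. *)
have : l ((l f)^-1 *: f) != 1.
  by apply: AU => x xA; rewrite -[LHS]/((l f)^-1 * f x) fA // mulr0.
by rewrite lZ -[_ *: _]/((l f)^-1 * l f) mulVf // eqxx.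
Qed.

Definition unit_vector (R : pzRingType) (X : Type) (x : X) : power R X :=
  fun y => ((y : {classic X}) == x)%:R.

Lemma unit_vector_notin (R : pzRingType) (X : Type) (A : {fset {classic X}})
    (x y : {classic X}) :
  x \notin A -> y \in A -> unit_vector R x y = 0.
Proof.
by move=> xA yA; rewrite /unit_vector; case: eqP => // yx; rewrite -yx yA in xA.
Qed.

(** Recovers [p] from [lambda p], which gives injectivity. *)
Lemma lambda_unit_vector (R : topComRingType) (X : Type) (p : finsupp R X) x :
  lambda p (unit_vector R x) = p x.
Proof.
have [A pA] := finsupp_fset p.
(* Adjoining [x] to [A] lets its term be split off even if [p x = 0]. *)
rewrite -[LHS]/(lambda_fun p _) (@lambda_funE _ _ p ((x : {classic X}) |` A)%fset); last first.
  by move=> y; rewrite inE negb_or => /andP[_ /pA].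
rewrite (big_fsetD1 (x : {classic X})) /= ?fset1U1 //.
rewrite /unit_vector eqxx mulr1 big_seq big1 ?addr0// => y.
by rewrite !inE => /andP[/negPf -> _]; rewrite mulr0.
Qed.

(** For [x] outside the finite set [A] of [dual_vanish], the unit vector at [x] vanishes on [A], so
    [l] kills it. *)
Lemma dual_unit_vector_finsupp (k : ringTopFieldType) (X : Type) (l : dual k X) :
  ((fun x => l (unit_vector k x)) : power k X) \in @finsupp_pred k X.
Proof.
have [A lA] := dual_vanish l; apply/asboolP.
apply: (@sub_finite_set _ _ [set` A]) => [x /= lx0|]; last exact: finite_fset.
apply: contraNT lx0 => xA; apply/eqP/lA => y; exact: unit_vector_notin.
Qed.

Lemma lambda_dual (k : ringTopFieldType) (X : Type) (l : dual k X) :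
  lambda (Finsupp (dual_unit_vector_finsupp l)) = l.
Proof.
apply: val_inj; apply/funext => f /=.
have [A lA] := dual_vanish l.
have /asboolP[linl _] := dual_valP l.
rewrite (@lambda_funE _ _ _ A); last first.
  by move=> x xA; apply: lA => y; exact: unit_vector_notin.
pose L := HB.pack_for {linear power k X -> k^o} (l : power k X -> k^o)
  (GRing.isLinear.Build k (power k X) k^o *:%R l linl).
(* [g] agrees with [f] on [A] and is zero elsewhere, so [l] kills [f - g]. *)
pose g : power k X := \sum_(x <- A) f x *: unit_vector k x.
have gE : L g = \sum_(x <- A) l (unit_vector k x) * f x.
  by rewrite linear_sum; apply: eq_bigr => x _; rewrite linearZ mulrC.
rewrite -gE; apply/esym/eqP; rewrite -subr_eq0 -[l f]/(L f) -linearB.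
apply/eqP/lA => x xA.
rewrite -[LHS]/(f x - g x) /g.
have -> : (\sum_(x <- A) f x *: unit_vector k x) x =
    \sum_(y <- A) f y * unit_vector k y x.
  by elim/big_ind2: _ => // u a v b <- <-.
rewrite (big_fsetD1 x xA) /= /unit_vector eqxx mulr1 big_seq big1 ?addr0 ?subrr //.
by move=> y; rewrite !inE eq_sym => /andP[/negPf -> _]; rewrite mulr0.
Qed.

Lemma ringTopField_rigid (k : ringTopFieldType) : rigid k.
Proof.
move=> X; exists (fun l => Finsupp (dual_unit_vector_finsupp l)); last first.
  exact: lambda_dual.
move=> p; apply: val_inj; apply/funext => x; exact: lambda_unit_vector.
Qed.

Theorem lemma17 :
  (forall k : ringTopFieldType, rigid k) /\ (forall k : topFieldType, rigid k).
Proof. by split=> k; exact: ringTopField_rigid. Qed.
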